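(* Let $(\mathfrak g,\mathfrak v,\pi)$ be a Lorentzian data set. Then $\mathfrak g$ is not semisimple (i.e. the center $\mathfrak c$ of $\mathfrak g$ satisfies $\mathfrak c\neq\{0\}$).
   Context: All vector spaces and Lie algebras are real and finite-dimensional; ''metric'' or ''inner product'' means a non-degenerate symmetric bilinear form, not necessarily definite. $\mathfrak{so}(V)$ is the Lie algebra of skew-symmetric endomorphisms of $V$ with respect to its metric. A data set is a triple $(\mathfrak g,\mathfrak v,\pi)$ where: $\mathfrak g$ is a Lie algebra with an ad-invariant metric $\langle\cdot,\cdot\rangle_{\mathfrak g}$ (i.e. $\mathrm{ad}_Z\in\mathfrak{so}(\mathfrak g)$ for all $Z\in\mathfrak g$); $\mathfrak v$ is a real vector space; $\pi:\mathfrak g\to\mathrm{End}(\mathfrak v)$ is a real faithful representation without trivial subrepresentations, i.e. $\bigcap_{Z\in\mathfrak g}\ker\pi(Z)=\{0\}$; and $\mathfrak v$ has a $\pi(\mathfrak g)$-invariant inner product $\langle\cdot,\cdot\rangle_{\mathfrak v}$, i.e. $\pi(\mathfrak g)\subset\mathfrak{so}(\mathfrak v)$. It is a Lorentzian data set if the orthogonal direct sum metric on $\mathfrak n=\mathfrak g\oplus\mathfrak v$ has signature one (exactly one negative direction). *)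

(* Defs.v *)
From HB Require Import structures.
From mathcomp Require Import all_boot all_order all_algebra.
From mathcomp Require Import sesquilinear reals.

Set Implicit Arguments.
Unset Strict Implicit.
Unset Printing Implicit Defensive.

Import Order.TTheory GRing.Theory Num.Theory.
Local Open Scope ring_scope.

Section LieAlgebra.
Variables (R : realType) (g : vectType R) (br : {bilinear g -> g -> g}).

Definition lie_bracket : Prop :=
  (forall x, br x x = 0) /\
  (forall x y z, br x (br y z) + br y (br z x) + br z (br x y) = 0).

Definition ad (x : g) : 'End(g) := linfun (br x).

Fact ad_is_linear : linear ad.
Proof.
move=> a x y; apply/lfunP => z; rewrite add_lfunE scale_lfunE !lfunE /=.
exact: linearPl.
Qed.
HB.instance Definition _ := GRing.isLinear.Build R g 'End(g) _ ad ad_is_linear.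

Definition center : {vspace g} := lker (linfun ad).

Lemma mem_center (z : g) : reflect (forall x, br z x = 0) (z \in center).
Proof.
rewrite memv_ker lfunE /=; apply: (iffP eqP) => [z0 x|z0].
  by have := congr1 (fun f : 'End(g) => f x) z0; rewrite zero_lfunE lfunE.
by apply/lfunP => x; rewrite zero_lfunE lfunE /= z0.
Qed.

Definition ideal (U : {vspace g}) : Prop :=
  forall x u, u \in U -> br x u \in U.

Definition derived (U : {vspace g}) : {vspace g} :=
  <<[seq br x y | x <- vbasis U, y <- vbasis U]>>%VS.

Definition solvable_sub (U : {vspace g}) : Prop :=
  exists n, iter n derived U = 0%VS.

(* vanishing of the solvable radical; the zero algebra counts as semisimple *)
Definition semisimple : Prop :=
  forall U : {vspace g}, ideal U -> solvable_sub U -> U = 0%VS.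

End LieAlgebra.

Section Metric.
Variable R : realType.

Definition in_so (V : vectType R) (f : {symmetric V}) (A : 'End(V)) : Prop :=
  forall x y, f (A x) y = - f x (A y).

Definition neg_definite_on (V : vectType R) (f : {symmetric V})
    (U : {vspace V}) : Prop :=
  forall u, u \in U -> u != 0 -> f u u < 0.

(* For a nondegenerate [f] this says that [k] is the number of negative signs
   in any diagonalization of [f]. *)
Definition has_signature (V : vectType R) (f : {symmetric V}) (k : nat) : Prop :=
  (exists2 U : {vspace V}, neg_definite_on f U & \dim U = k) /\
  (forall U : {vspace V}, neg_definite_on f U -> (\dim U <= k)%N).

End Metric.

Section OrthogonalSum.
Variables (R : realType) (V W : vectType R).
Variables (f : {symmetric V}) (h : {symmetric W}).

Definition sum_form (x y : V * W) : R := f x.1 y.1 + h x.2 y.2.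

Fact sum_form_is_bilinear :
  bilinear_for
    (GRing.Scale.Law.clone _ _ ( *%R ) _) (GRing.Scale.Law.clone _ _ (idfun \; *%R ) _)
    sum_form.
Proof.
split=> [u a x y|u a x y]; rewrite /sum_form /=.
  by rewrite !linearPl /= mulrDr addrACA.
by rewrite !linearPr /= mulrDr addrACA.
Qed.
HB.instance Definition _ :=
  bilinear_isBilinear.Build R (V * W)%type (V * W)%type R _ _ sum_form
    sum_form_is_bilinear.

Fact sum_form_is_sym : forall x y : V * W, sum_form x y = (-1) ^+ false * idfun (sum_form y x).
Proof.
by move=> x y; rewrite /sum_form hermC [h _ _]hermC /= expr0 !mul1r.
Qed.
HB.instance Definition _ :=
  isHermitianSesquilinear.Build R (V * W)%type false idfun sum_form
    sum_form_is_sym.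

End OrthogonalSum.

Section DataSet.
Variables (R : realType) (g v : vectType R).
Variables (br : {bilinear g -> g -> g}) (pi : 'Hom(g, 'End(v))).
Variables (fg : {symmetric g}) (fv : {symmetric v}).

Record data_set : Prop := DataSet {
  ds_lie : lie_bracket br;
  ds_metric_g : nondegenerate fg;
  ds_ad_invariant : forall Z, in_so fg (ad br Z);
  ds_representation :
    forall X Y, pi (br X Y) = (pi X \o pi Y)%VF - (pi Y \o pi X)%VF;
  ds_faithful : lker pi = 0%VS;
  ds_no_trivial : forall w, (forall Z, pi Z w = 0) -> w = 0;
  ds_metric_v : nondegenerate fv;
  ds_pi_invariant : forall Z, in_so fv (pi Z)
}.

Definition lorentzian_data_set : Prop :=
  data_set /\ has_signature (sum_form fg fv) 1.

End DataSet.

(* Main.v *)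
From HB Require Import structures.
Require Import Defs.
From mathcomp Require Import all_boot all_order all_algebra.
From mathcomp Require Import sesquilinear reals.
From mathcomp Require Import boolp classical_sets ring lra.

(** The single negative direction of [g (+) v] lies in exactly one summand, so
    one of the two metrics is Lorentzian and the other is positive definite.
    In both cases the definite summand provides, by averaging over one of its
    orthonormal bases, an invariant symmetric form [h] on the Lorentzian
    summand:
    - if [g] is Lorentzian, [h X Y = \sum_w <pi X w, pi Y w>] over a basis of
      [v], i.e. minus the trace form of [pi];
    - if [v] is Lorentzian, [h x y = \sum_e <pi e x, pi e y>] over a basis of
      [g], i.e. minus the form of the Casimir operator.
    Invariance is [orthonormal_skew_trace]. The form [h] is positive on nonzero
    causal vectors: in the first case because [pi] is faithful, in the second
    because [pi e x] is orthogonal to the causal vector [x], hence not timelike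
    ([causal_orthogonal]).

    The heart of the proof is [timelike_fixed_vector]: when [h] is positive on
    the nonzero causal vectors of a Lorentzian metric [f], some timelike vector
    is killed by all operators that are skew for both [f] and [h]. Indeed, let
    [t] be the infimum of [h w w / - f w w] over timelike [w]. The form
    [h + t f] is positive semidefinite ([pencil_threshold]), and since the
    infimum cannot be improved its kernel contains a timelike vector [T]. The
    kernel is stable under the skew operators, which send [T] into the part of
    the kernel orthogonal to [T]; that part is zero, because the kernel
    consists of solutions of [h x x = - t f x x] and so contains no null
    vector and not both a spacelike and a timelike one.

    If [g] is Lorentzian, this is applied to the operators [ad Z], and [T] is a
    central element. If [v] is Lorentzian and the centre is zero, it is applied
    to the operators [pi Z], and [T] is a trivial vector, which is excluded. In
    the second case [h] can only degenerate on an invariant line; the scalar by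
    which [g] acts on a line vanishes on brackets, so it is represented by an
    element orthogonal to all brackets, i.e. a central one, and the line would
    be trivial. A nonzero centre is an abelian ideal, so [g] is not
    semisimple. *)

Set Implicit Arguments.
Unset Strict Implicit.
Unset Printing Implicit Defensive.

Import Order.TTheory GRing.Theory Num.Theory.
Local Open Scope ring_scope.

(** * Symmetric bilinear forms *)

(** Forms are bare functions here, so that forms given by a sum over a basis or
    by a combination of two forms need no packaging. *)
Definition symmetric_bilinear (R : realType) (V : vectType R)
    (h : V -> V -> R) : Prop :=
  (forall a x y z, h (a *: x + y) z = a * h x z + h y z) /\
  (forall x y, h x y = h y x).

Lemma form_symmetric_bilinear (R : realType) (V : vectType R)
  (f : {symmetric V}) : symmetric_bilinear f.
Proof.
split=> [a x y z|x y]; first by rewrite linearPl.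
by rewrite hermC /= expr0 mul1r.
Qed.

Section SymmetricBilinear.
Variables (R : realType) (V : vectType R) (h : V -> V -> R).
Hypothesis hb : symmetric_bilinear h.

Lemma sbC x y : h x y = h y x.
Proof. by case: hb. Qed.

Lemma sbDl x y z : h (x + y) z = h x z + h y z.
Proof. by case: hb => hl _; rewrite -[x in LHS]scale1r hl mul1r. Qed.

Lemma sb0l z : h 0 z = 0.
Proof. by apply: (addrI (h 0 z)); rewrite -sbDl !addr0. Qed.

Lemma sbZl a x z : h (a *: x) z = a * h x z.
Proof. by case: hb => hl _; rewrite -[_ *: _]addr0 hl sb0l addr0. Qed.

Lemma sbDr x y z : h x (y + z) = h x y + h x z.
Proof. by rewrite sbC sbDl !(sbC x). Qed.

Lemma sb0r x : h x 0 = 0.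
Proof. by rewrite sbC sb0l. Qed.

Lemma sbZr a x z : h x (a *: z) = a * h x z.
Proof. by rewrite sbC sbZl (sbC x). Qed.

Lemma sb_suml I (r : seq I) (F : I -> V) z :
  h (\sum_(i <- r) F i) z = \sum_(i <- r) h (F i) z.
Proof. by apply: (big_morph (h^~ z)) => [x y|]; rewrite ?sbDl ?sb0l. Qed.

Lemma sb_quad a b x y :
  h (a *: x + b *: y) (a *: x + b *: y) =
  a ^+ 2 * h x x + 2 * a * b * h x y + b ^+ 2 * h y y.
Proof. by rewrite sbDl !sbDr !sbZl !sbZr (sbC y x); ring. Qed.

(** The vector [h y y *: x - h x y *: y] has square
    [h y y * (h x x * h y y - h x y ^+ 2)]; if [h y y = 0] a suitable multiple
    of [y] added to [x] would have negative square. *)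
Lemma psd_CauchySchwarz x y : (forall z, 0 <= h z z) ->
  h x y ^+ 2 <= h x x * h y y.
Proof.
move=> psd; have hyy := psd y.
have [y0|y0] := eqVneq (h y y) 0; last first.
  have y_gt0 : 0 < h y y by rewrite lt_def y0.
  have := psd (h y y *: x + (- h x y) *: y).
  rewrite sb_quad.
  have -> : h y y ^+ 2 * h x x + 2 * h y y * - h x y * h x y +
     (- h x y) ^+ 2 * h y y = h y y * (h x x * h y y - h x y ^+ 2) by ring.
  by rewrite pmulr_rge0 // subr_ge0.
have [->|hxy] := eqVneq (h x y) 0; first by rewrite y0 expr2 !mulr0.
have := psd (1 *: x + (- (h x x + 1) / (2 * h x y)) *: y).
rewrite sb_quad y0.
have -> : 1 ^+ 2 * h x x + 2 * 1 * (- (h x x + 1) / (2 * h x y)) * h x y +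
   (- (h x x + 1) / (2 * h x y)) ^+ 2 * 0 = -1 by field.
by lra.
Qed.

End SymmetricBilinear.

Lemma lfun_of_linear (R : realType) (V W : vectType R) (c : V -> W) :
  linear c -> exists C : 'Hom(V, W), C =1 c.
Proof.
move=> lc.
pose c' : {linear V -> W} := HB.pack c (GRing.isLinear.Build R V W _ c lc).
by exists (linfun c') => x; rewrite lfunE.
Qed.

Lemma lfun_of_bilinear (R : realType) (V : vectType R) (h : V -> V -> R) :
  symmetric_bilinear h ->
  exists H : 'Hom(V, 'Hom(V, R^o)), forall x y, H x y = h x y.
Proof.
move=> hb.
have lr x : linear (h x : V -> R^o).
  by move=> a y z; rewrite (sbDr hb) (sbZr hb).
pose F x : {linear V -> R^o} :=
  HB.pack (h x : V -> R^o) (GRing.isLinear.Build R V R^o _ (h x : V -> R^o) (lr x)).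
have lF : linear (fun x => linfun (F x)).
  move=> a x y; apply/lfunP => z; rewrite !lfun_simp /=.
  by rewrite (sbDl hb) (sbZl hb).
have [H HE] := lfun_of_linear lF.
by exists H => x y; rewrite HE lfunE.
Qed.

Lemma nondegenerate_eq0 (R : realType) (V : vectType R) (f : {symmetric V}) x :
  nondegenerate f -> (forall y, f x y = 0) -> x = 0.
Proof.
move=> /eqP nd fx0; apply/eqP; rewrite -memv0 -nd.
by apply/mem_orthovP => y _.
Qed.

(** The nondegenerate [f] identifies [V] with its dual, by a dimension count. *)
Lemma form_operator (R : realType) (V : vectType R) (f : {symmetric V})
    (h : V -> V -> R) :
  nondegenerate f -> symmetric_bilinear h ->
  exists C : 'End(V), forall x y, f (C x) y = h x y.
Proof.
move=> nd hb.
have [F FE] := lfun_of_bilinear (form_symmetric_bilinear f).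
have [H HE] := lfun_of_bilinear hb.
have kF : lker F == 0%VS.
  rewrite -subv0; apply/subvP => x; rewrite memv_ker memv0 => /eqP Fx0.
  apply/eqP; apply: (nondegenerate_eq0 (f := f)) => // y.
  by rewrite -FE Fx0 zero_lfunE.
have F_onto : limg F = fullv.
  apply/eqP; rewrite eqEdim subvf /= limg_dim_eq; last first.
    by rewrite (eqP kF) capv0.
  by rewrite !dimvf /dim /= muln1.
exists (F^-1 \o H)%VF => x y.
by rewrite -FE comp_lfunE /= limg_lfunVK ?F_onto ?memvf.
Qed.

(** Gram-Schmidt: split off a unit vector [u] of a subspace, and continue in
    the orthogonal complement of [u] in that subspace. *)
Lemma orthonormal_expansion (R : realType) (V : vectType R) (h : V -> V -> R) :
  symmetric_bilinear h -> (forall x, x != 0 -> 0 < h x x) ->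
  exists s : seq V, forall x, x = \sum_(e <- s) h x e *: e.
Proof.
move=> hb pd.
(* Membership of the list in the subspace makes the induction go through. *)
suff [s [_ sP]] : exists s : seq V, {subset s <= {:V}%VS} /\
    {in {:V}%VS, forall x, x = \sum_(e <- s) h x e *: e}.
  by exists s => x; apply/sP/memvf.
move: (@fullv R V) => U; have [n] := ubnP (\dim U).
elim: n U => // n IHn U; rewrite ltnS => leUn.
have [->|/eqP U0] := U =P 0%VS.
  by exists [::]; split=> // x; rewrite memv0 big_nil => /eqP.
have [v vU v0] : exists2 v, v \in U & v != 0.
  by exists (vpick U); rewrite ?memv_pick ?vpick0.
pose u := (Num.sqrt (h v v))^-1 *: v.
have huu : h u u = 1.
  have hv := pd _ v0.
  rewrite (sbZl hb) (sbZr hb) mulrA -expr2 exprVn.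
  by rewrite sqr_sqrtr ?ltW // mulVf ?gt_eqF.
have uU : u \in U by rewrite memvZ.
have [L LE] := lfun_of_bilinear hb.
pose W := (U :&: lker (L u))%VS.
have WP x : (x \in W) = (x \in U) && (h u x == 0).
  by rewrite memv_cap memv_ker LE.
have dimW : (\dim W < n)%N.
  apply: leq_trans leUn; rewrite ltn_neqAle dimvS ?capvSl // andbT.
  apply/negP => /eqP dWU.
  have : W == U by rewrite eqEdim capvSl dWU leqnn.
  move/eqP => WU; have := uU; rewrite -WU WP huu uU /=.
  by rewrite oner_eq0.
have [s [sW sP]] := IHn W dimW.
exists (u :: s); split.
  move=> x; rewrite inE => /predU1P[->//|/sW].
  by rewrite WP => /andP[].
move=> x xU; rewrite big_cons; pose y := x + (- h x u) *: u.
have yW : y \in W.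
  rewrite WP memvD ?memvZ //= (sbDr hb) (sbZr hb) huu.
  by rewrite (sbC hb u) mulr1 subrr.
rewrite -[LHS](addrNK (h x u *: u)) -scaleNr -/y addrC; congr (_ + _).
rewrite [LHS]sP //; apply: eq_big_seq => e /sW; rewrite WP => /andP[_ /eqP ue].
by rewrite (sbDl hb) (sbZl hb) ue mulr0 addr0.
Qed.

(** * Lorentzian forms and positivity on causal vectors *)

(** For a nondegenerate [f] this says that [f] has signature one. *)
Definition lorentzian (R : realType) (V : vectType R) (f : V -> V -> R) : Prop :=
  (exists T, f T T < 0) /\
  (forall a b, f a a < 0 -> f a b = 0 -> 0 <= f b b).

Section Pencil.
Variables (R : realType) (V : vectType R) (f h : V -> V -> R).
Hypotheses (fb : symmetric_bilinear f) (hb : symmetric_bilinear h).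
Hypothesis f_lor : lorentzian f.
Hypothesis h_causal : forall x, x != 0 -> f x x <= 0 -> 0 < h x x.

(** The component of [y] orthogonal to the timelike [x] is not timelike. *)
Lemma lorentzian_reverse_CauchySchwarz x y :
  f x x < 0 -> f x x * f y y <= f x y ^+ 2.
Proof.
move=> xx_lt0.
have /(f_lor.2 _ _ xx_lt0) : f x (f x x *: y + (- f x y) *: x) = 0.
  by rewrite (sbDr fb) !(sbZr fb); ring.
rewrite (sb_quad fb) (sbC fb y x).
have -> : f x x ^+ 2 * f y y + 2 * f x x * - f x y * f x y +
  (- f x y) ^+ 2 * f x x = f x x * (f x x * f y y - f x y ^+ 2) by ring.
by rewrite nmulr_rge0 // subr_le0.
Qed.

(** The plane spanned by [u] and [w] contains two null lines, generated by
    [u + r1 w] and [u + r2 w] with [r1 * r2 < 0]. A positive combination of the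
    values of [h] on these two generators eliminates the cross term [h u w]. *)
Lemma timelike_spacelike_gap u w : 0 < f u u -> f w w < 0 ->
  0 < h u u * - f w w + h w w * f u u.
Proof.
set al := f w w; set be := f u u; set c := f u w => be_gt0 al_lt0.
pose D := c ^+ 2 - al * be.
have D_gt0 : 0 < D by rewrite /D; nra.
pose s := Num.sqrt D.
have s2 : s ^+ 2 = c ^+ 2 - al * be by rewrite sqr_sqrtr ?ltW.
have s_gt0 : 0 < s by rewrite sqrtr_gt0.
have null r : al * r = - c + s \/ al * r = - c - s ->
    0 < h u u + 2 * r * h u w + r ^+ 2 * h w w.
  move=> hr.
  have nz : 1 *: u + r *: w != 0.
    apply: contraTneq be_gt0 => /eqP; rewrite scale1r addr_eq0 => /eqP uE.
    rewrite /be uE -scaleNr (sbZl fb) (sbZr fb) -leNgt -/al.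
    by rewrite mulrA -expr2 mulr_ge0_le0 ?sqr_ge0 ?ltW.
  have fnull : f (1 *: u + r *: w) (1 *: u + r *: w) = 0.
    rewrite (sb_quad fb) -/al -/be -/c.
    apply: (mulfI (lt0r_neq0 _ : - al != 0)); first by rewrite oppr_gt0.
    have alr : (al * r + c) ^+ 2 = s ^+ 2 by case: hr => ->; ring.
    have : al * (be + 2 * c * r + al * r ^+ 2) = 0.
      have -> : al * (be + 2 * c * r + al * r ^+ 2) =
        (al * r + c) ^+ 2 - (c ^+ 2 - al * be) by ring.
      by rewrite alr s2 subrr.
    by nra.
  have := h_causal nz; rewrite fnull lexx => /(_ isT).
  by rewrite (sb_quad hb); nra.
have al0 : al != 0 by rewrite lt_eqF.
pose r1 := (- c + s) / al; pose r2 := (- c - s) / al.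
have r1E : al * r1 = - c + s by rewrite mulrC divfK.
have r2E : al * r2 = - c - s by rewrite mulrC divfK.
have albe : al * be < 0 by rewrite nmulr_rlt0.
have cs1 : c < s by rewrite ltNge; apply/negP => ?; nra.
have cs2 : - s < c by rewrite ltNge; apply/negP => ?; nra.
(* The weights [c + s] and [s - c] are [- al * r2] and [al * r1], so that the
   coefficient of [h u w] is a multiple of [- r2 * r1 + r1 * r2 = 0]. *)
have N1 := null r1 (or_introl r1E); have N2 := null r2 (or_intror r2E).
have N1' : 0 < (c + s) * (h u u + 2 * r1 * h u w + r1 ^+ 2 * h w w).
  by rewrite mulr_gt0 //; lra.
have N2' : 0 < (s - c) * (h u u + 2 * r2 * h u w + r2 ^+ 2 * h w w).
  by rewrite mulr_gt0 //; lra.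
have key : al * ((c + s) * (h u u + 2 * r1 * h u w + r1 ^+ 2 * h w w) +
    (s - c) * (h u u + 2 * r2 * h u w + r2 ^+ 2 * h w w)) =
    - (2 * s) * (h u u * - al + h w w * be).
  transitivity (al * ((c + s) * h u u + (s - c) * h u u) +
    2 * h u w * ((c + s) * (al * r1) + (s - c) * (al * r2)) +
    h w w * ((c + s) * (al * r1) * r1 + (s - c) * (al * r2) * r2)); first by ring.
  rewrite r1E r2E.
  have -> : (c + s) * (- c + s) * r1 + (s - c) * (- c - s) * r2 =
     - be * (al * r1 - al * r2).
    have -> : (c + s) * (- c + s) = - (al * be).
      by transitivity (s ^+ 2 - c ^+ 2); [ring | rewrite s2; ring].
    have -> : (s - c) * (- c - s) = al * be.
      by transitivity (c ^+ 2 - s ^+ 2); [ring | rewrite s2; ring].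
    ring.
  rewrite r1E r2E; ring.
have : al * ((c + s) * (h u u + 2 * r1 * h u w + r1 ^+ 2 * h w w) +
    (s - c) * (h u u + 2 * r2 * h u w + r2 ^+ 2 * h w w)) < 0.
  by rewrite nmulr_rlt0 // addr_gt0.
by rewrite key nmulr_rlt0 //; lra.
Qed.

(** The threshold is the infimum of [h w w / - f w w] over timelike [w]. On
    timelike vectors semidefiniteness is the definition of [t], on null vectors
    it is the positivity of [h], and on spacelike vectors it holds because
    [timelike_spacelike_gap] makes [- h u u / f u u] a lower bound. *)
Lemma pencil_threshold : exists t,
  (forall x, 0 <= h x x + t * f x x) /\
  (forall d, 0 < d -> exists2 w, f w w < 0 & h w w + t * f w w < d * - f w w).
Proof.
pose S : set R := fun r => exists2 w, f w w < 0 & r = h w w / - f w w.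
have [T0 T0_lt0] := f_lor.1.
have S0 : nonempty S by exists (h T0 T0 / - f T0 T0); exists T0.
have Sge (x : V) m : (forall w, f w w < 0 -> m * - f w w <= h w w) -> lbound S m.
  by move=> mP _ [w w_lt0 ->]; rewrite ler_pdivlMr ?oppr_gt0 // mP.
have Slb : has_lbound S.
  exists 0; apply: (Sge 0) => w w_lt0; rewrite mul0r ltW // h_causal ?ltW //.
  by apply: contraTneq w_lt0 => ->; rewrite (sb0l fb) ltxx.
exists (inf S); split.
  move=> x; have [x_gt0|x_lt0|x_0] := ltrgt0P (f x x).
  - have : - h x x / f x x <= inf S.
      apply: lb_le_inf => //; apply: (Sge 0) => w w_lt0.
      have := timelike_spacelike_gap x_gt0 w_lt0 => gap.
      rewrite mulrAC ler_pdivrMr //; lra.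
    by rewrite ler_pdivrMr //; lra.
  - have := ge_inf Slb (ex_intro2 _ _ x x_lt0 erefl).
    by rewrite ler_pdivlMr ?oppr_gt0 //; lra.
  - rewrite ?x_0 mulr0 addr0; have [->|x0] := eqVneq x 0; first by rewrite (sb0l hb).
    by rewrite ltW // h_causal // x_0.
move=> d d_gt0; have [_ [w w_lt0 ->]] := inf_adherent d_gt0 (conj S0 Slb).
rewrite ltr_pdivrMr ?oppr_gt0 // => w_lt.
by exists w => //; lra.
Qed.

End Pencil.

(** With [C] the operator of [h] relative to [f] and [Q = C + t], the kernel of
    the threshold form [q] is [lker Q]. It contains no null vector; if it had
    no timelike one either, it would be a complement of its orthogonal
    [limg Q], so that some timelike vector would be of the form [Q y]. The
    reverse Cauchy-Schwarz inequality for [f] and the usual one for [q] then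
    bound [q w w] below by a fixed multiple of [- f w w] on timelike [w],
    against the choice of [t]. *)
Lemma timelike_fixed_vector (R : realType) (V : vectType R) (f : {symmetric V})
    (h : V -> V -> R) :
  nondegenerate f -> lorentzian f -> symmetric_bilinear h ->
  (forall x, x != 0 -> f x x <= 0 -> 0 < h x x) ->
  exists2 T, f T T < 0 &
    forall A : 'End(V), in_so f A -> (forall x y, h (A x) y = - h x (A y)) ->
      A T = 0.
Proof.
move=> nd lor hb h_causal.
have fb := form_symmetric_bilinear f.
have [t [q_ge0 q_inf]] := pencil_threshold fb hb lor h_causal.
have [C CE] := form_operator nd hb.
pose Q : 'End(V) := C + t *: \1%VF.
pose q x y := f (Q x) y.
have qE x y : q x y = h x y + t * f x y.
  by rewrite /q !lfun_simp (sbDl fb) (sbZl fb) CE.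
have qb : symmetric_bilinear q.
  split=> [a x y z|x y]; last by rewrite !qE (sbC hb) (sbC fb).
  by rewrite !qE !(sbDl fb, sbDl hb, sbZl fb, sbZl hb); ring.
have q_psd x : 0 <= q x x by rewrite qE.
have kerE x : x \in lker Q -> h x x = - t * f x x.
  rewrite memv_ker => /eqP Qx0.
  have : q x x = 0 by rewrite /q Qx0 (sb0l fb).
  by rewrite qE; lra.
have ker_null x : x \in lker Q -> f x x = 0 -> x = 0.
  move=> /kerE hx fx; apply/eqP/negPn/negP => x0.
  by have := h_causal _ x0; rewrite hx fx lexx mulr0 ltxx => /(_ isT).
have [T T_ker T_lt0] : exists2 T, T \in lker Q & f T T < 0.
  apply: contrapT => no.
  have capQ : (lker Q :&: limg Q)%VS = 0%VS.
    apply/eqP; rewrite -subv0; apply/subvP => e.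
    rewrite memv_cap memv0 => /andP[eker /memv_imgP[y _ eE]].
    apply/eqP/ker_null => //; rewrite {1}eE -/(q y e) (sbC qb) /q.
    by move: eker; rewrite memv_ker => /eqP ->; rewrite (sb0l fb).
  have sumQ : (lker Q + limg Q)%VS = fullv.
    apply/eqP; rewrite eqEdim subvf dimv_disjoint_sum //=.
    by rewrite -(limg_ker_dim Q fullv) capfv.
  have [T0 T0_lt0] := lor.1.
  have : T0 \in (lker Q + limg Q)%VS by rewrite sumQ memvf.
  case/memv_addP => e eker [_ /memv_imgP[y _ ->] T0E].
  have eQy : f e (Q y) = 0.
    rewrite (sbC fb) -/(q y e) (sbC qb) /q.
    by move: eker; rewrite memv_ker => /eqP ->; rewrite (sb0l fb).
  have e_ge0 : 0 <= f e e.
    by rewrite leNgt; apply/negP => e_lt0; apply: no; exists e.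
  have Qy_lt0 : f (Q y) (Q y) < 0.
    move: T0_lt0; rewrite T0E (sbDl fb) !(sbDr fb) eQy (sbC fb _ e) eQy; lra.
  have bound w : f (Q y) (Q y) * f w w <= q y y * q w w.
    have := psd_CauchySchwarz qb y w q_psd.
    exact/le_trans/(lorentzian_reverse_CauchySchwarz fb lor w Qy_lt0).
  have qy_gt0 : 0 < q y y.
    rewrite lt_def q_psd andbT; apply: contraTneq T0_lt0 => qy0.
    have := bound T0; rewrite qy0 mul0r -leNgt; nra.
  have d_gt0 : 0 < - f (Q y) (Q y) / q y y by rewrite divr_gt0 ?oppr_gt0.
  have [w w_lt0] := q_inf _ d_gt0; rewrite -qE.
  rewrite mulrAC ltr_pdivlMr //.
  by have := bound w; lra.
exists T => // A Aso Ah.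
have Aq x y : q (A x) y = - q x (A y) by rewrite !qE Aso Ah; ring.
have AT_ker : A T \in lker Q.
  rewrite memv_ker; apply/eqP/(nondegenerate_eq0 nd) => y.
  rewrite -/(q (A T) y) Aq /q.
  by move: T_ker; rewrite memv_ker => /eqP ->; rewrite (sb0l fb) oppr0.
have AT_orth : f T (A T) = 0.
  by have := Aso T T; rewrite (sbC fb _ T); lra.
have AT_ge0 := lor.2 _ _ T_lt0 AT_orth.
(* [A T] lies in the kernel of [q] together with the timelike [T], so it cannot
   be spacelike. *)
apply: (ker_null _ AT_ker).
apply/eqP; rewrite eq_le AT_ge0 andbT leNgt; apply/negP => AT_gt0.
have := timelike_spacelike_gap fb hb h_causal AT_gt0 T_lt0.
rewrite (kerE _ AT_ker) (kerE _ T_ker); lra.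
Qed.

Lemma nondegenerate_psd_pos (R : realType) (V : vectType R) (f : {symmetric V}) :
  nondegenerate f -> (forall x, 0 <= f x x) -> forall x, x != 0 -> 0 < f x x.
Proof.
move=> nd psd x x0; rewrite lt_def psd andbT; apply: contraNneq x0 => fx.
apply/eqP/(nondegenerate_eq0 nd) => y; apply/eqP; rewrite -sqrf_eq0.
have := psd_CauchySchwarz (form_symmetric_bilinear f) x y psd.
by rewrite fx mul0r => le0; rewrite eq_le le0 sqr_ge0.
Qed.

(** Removing the [T]-component from [f] leaves a positive semidefinite form,
    whose Cauchy-Schwarz inequality puts [y] in the radical of [f]. *)
Lemma timelike_orthogonal_null (R : realType) (V : vectType R)
    (f : {symmetric V}) T y :
  nondegenerate f -> lorentzian f -> f T T < 0 -> f T y = 0 -> f y y = 0 ->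
  y = 0.
Proof.
move=> nd lor T_lt0 Ty yy; have fb := form_symmetric_bilinear f.
pose p x z := f x z - f T x * f T z / f T T.
have pb : symmetric_bilinear p.
  split=> [a x z u|x z]; rewrite /p ?(sbC fb x z); last by rewrite (mulrC (f T x)).
  by rewrite (sbDl fb) (sbZl fb) (sbDr fb) (sbZr fb); ring.
have p_psd x : 0 <= p x x.
  have := lorentzian_reverse_CauchySchwarz fb lor x T_lt0.
  by rewrite /p subr_ge0 ler_ndivrMr // -expr2 mulrC.
apply: (nondegenerate_eq0 nd) => z; apply/eqP; rewrite -sqrf_eq0.
have := psd_CauchySchwarz pb y z p_psd.
rewrite /p Ty yy !mul0r !subr0 mul0r => le0.
by rewrite eq_le le0 sqr_ge0.
Qed.

(** For a null [w], moving [y] along [w] leaves its square unchanged and makes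
    it orthogonal to a given timelike vector. *)
Lemma causal_orthogonal (R : realType) (V : vectType R) (f : {symmetric V}) w y :
  nondegenerate f -> lorentzian f -> w != 0 -> f w w <= 0 -> f w y = 0 ->
  0 <= f y y /\ (f y y = 0 -> exists l, y = l *: w).
Proof.
move=> nd lor w0 ww wy; have fb := form_symmetric_bilinear f.
have [w_lt0|w_ge0] := ltP (f w w) 0.
  split=> [|yy]; first exact: lor.2 w_lt0 wy.
  by exists 0; rewrite scale0r; apply: timelike_orthogonal_null wy yy.
have {w_ge0}ww0 : f w w = 0 by apply/eqP; rewrite eq_le ww.
have [T T_lt0] := lor.1.
have Tw : f T w != 0.
  by apply: contraNneq w0 => Tw; rewrite (timelike_orthogonal_null _ _ T_lt0 Tw).
pose l := f T y / f T w; pose y' := 1 *: y + (- l) *: w.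
have Ty' : f T y' = 0.
  by rewrite (sbDr fb) !(sbZr fb) /l; field.
have yy' : f y' y' = f y y.
  by rewrite (sb_quad fb) (sbC fb y w) wy ww0; ring.
rewrite -yy'; split=> [|y'0]; first exact: lor.2 T_lt0 Ty'.
exists l; apply/eqP; rewrite -subr_eq0.
have := timelike_orthogonal_null nd lor T_lt0 Ty' y'0.
by rewrite /y' scale1r scaleNr => ->.
Qed.

(** Two orthogonal timelike vectors would span a negative definite plane. *)
Lemma signature_one_orthogonal (R : realType) (V : vectType R)
    (f : {symmetric V}) a b :
  has_signature f 1 -> f a a < 0 -> f a b = 0 -> 0 <= f b b.
Proof.
move=> [_ sig] a_lt0 ab; have fb := form_symmetric_bilinear f.
rewrite leNgt; apply/negP => b_lt0.
have neq0 x : f x x < 0 -> x != 0.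
  by move=> x_lt0; apply: contraTneq x_lt0 => ->; rewrite (sb0l fb) ltxx.
have /sig : neg_definite_on f (<[a]> + <[b]>).
  move=> _ /memv_addP[_ /vlineP[s ->] [_ /vlineP[r ->] ->]] sr0.
  rewrite (sb_quad fb) ab mulr0 addr0.
  have [s0|s0] := eqVneq s 0; last first.
    rewrite ltr_wnDr //; last by rewrite nmulr_llt0 // lt_def sqrf_eq0 s0 sqr_ge0.
    by rewrite mulr_ge0_le0 ?sqr_ge0 ?ltW.
  rewrite s0 expr2 !mul0r add0r nmulr_llt0 // lt_def sqr_ge0 sqrf_eq0 andbT.
  by apply: contraNneq sr0 => ->; rewrite s0 !scale0r addr0.
rewrite dimv_disjoint_sum; first by rewrite !dim_vline !neq0.
apply/eqP; rewrite -subv0; apply/subvP => x.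
rewrite memv_cap memv0 => /andP[/vlineP[s ->] /vlineP[r sr]].
have : f a (s *: a) = 0 by rewrite sr (sbZr fb) ab mulr0.
rewrite (sbZr fb) => /eqP; rewrite mulf_eq0 (lt_eqF a_lt0) orbF => /eqP ->.
by rewrite scale0r.
Qed.

(** In the basis [s] the matrix of [A] is antisymmetric, while the matrix of
    the form [b x y + b y x] is symmetric. For [b] built from a representation,
    this is the invariance of its trace form and of its Casimir operator. *)
Lemma orthonormal_skew_trace (R : realType) (V : vectType R) (h : V -> V -> R)
    (s : seq V) (A : V -> V) (b : V -> V -> R) :
  symmetric_bilinear h -> (forall x, x = \sum_(e <- s) h x e *: e) ->
  (forall x y, h (A x) y = - h x (A y)) ->
  (forall a x y z, b (a *: x + y) z = a * b x z + b y z) ->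
  (forall a x y z, b z (a *: x + y) = a * b z x + b z y) ->
  \sum_(e <- s) (b (A e) e + b e (A e)) = 0.
Proof.
move=> hb sE skew bl br.
have b0l z : b 0 z = 0 by have := bl (-1) 0 0 z; rewrite scaler0 addr0; lra.
have b0r z : b z 0 = 0 by have := br (-1) 0 0 z; rewrite scaler0 addr0; lra.
have bsl (c : V -> R) z : b (\sum_(e <- s) c e *: e) z = \sum_(e <- s) c e * b e z.
  by elim: s {sE} => [|e s' IH]; rewrite ?big_nil // !big_cons bl IH.
have bsr (c : V -> R) z : b z (\sum_(e <- s) c e *: e) = \sum_(e <- s) c e * b z e.
  by elim: s {sE bsl} => [|e s' IH]; rewrite ?big_nil // !big_cons br IH.
rewrite big_split /=.
under eq_bigr => e _ do rewrite [in X in b X _](sE (A e)) bsl.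
under [X in _ + X]eq_bigr => e _ do rewrite [in X in b _ X](sE (A e)) bsr.
rewrite [X in _ + X]exchange_big -big_split big1 // => e _.
rewrite -big_split big1 // => e' _ /=.
by rewrite skew (sbC hb e) -mulrDl addNr mul0r.
Qed.

(** * The two kinds of Lorentzian data sets *)

Section DataSetCases.
Variables (R : realType) (g v : vectType R).
Variables (br : {bilinear g -> g -> g}) (pi : 'Hom(g, 'End(v))).
Variables (fg : {symmetric g}) (fv : {symmetric v}).
Hypothesis ds : data_set br pi fg fv.

Let gb := form_symmetric_bilinear fg.
Let vb := form_symmetric_bilinear fv.

Lemma repr_bracket X Y w : pi (br X Y) w = pi X (pi Y w) - pi Y (pi X w).
Proof. by rewrite (ds_representation ds) !lfun_simp. Qed.

Lemma repr_linear a X Y w : pi (a *: X + Y) w = a *: pi X w + pi Y w.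
Proof. by rewrite linearP !lfun_simp. Qed.

Lemma bracket_anti X Y : br X Y = - br Y X.
Proof.
have [alt _] := ds_lie ds.
apply/eqP; rewrite -addr_eq0; have := alt (X + Y).
by rewrite linearDl !linearDr !alt add0r addr0 => ->.
Qed.

Lemma ad_skew Z X Y : fg (br Z X) Y = - fg X (br Z Y).
Proof. by have := ds_ad_invariant ds Z X Y; rewrite !lfunE. Qed.

(** Minus the trace form of [pi] is invariant and, [pi] being faithful and
    [fv] definite, positive definite; the timelike vector killed by all
    [ad Z] is central. *)
Lemma lorentzian_algebra_center :
  lorentzian fg -> (forall x, x != 0 -> 0 < fv x x) ->
  exists2 T, T != 0 & forall Z, br T Z = 0.
Proof.
move=> lor pd.
have [s sE] := orthonormal_expansion vb pd.
pose h X Y := \sum_(w <- s) fv (pi X w) (pi Y w).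
have hb : symmetric_bilinear h.
  split=> [a X Y Z|X Y]; last by apply: eq_bigr => w _; apply: sbC.
  rewrite mulr_sumr -big_split; apply: eq_bigr => w _ /=.
  by rewrite repr_linear (sbDl vb) (sbZl vb).
have h_causal X : X != 0 -> fg X X <= 0 -> 0 < h X X.
  move=> X0 _; have fv_ge0 x : 0 <= fv x x.
    by have [->|/pd/ltW//] := eqVneq x 0; rewrite (sb0l vb).
  rewrite lt_def sumr_ge0 // andbT; apply: contraNneq X0 => /eqP.
  rewrite psumr_eq0 // => /allP hX0.
  rewrite -memv0 -(ds_faithful ds) memv_ker; apply/eqP/lfunP => x.
  rewrite zero_lfunE (sE x) linear_sum big1_seq // => w /andP[_ ws].
  rewrite linearZ /=; apply/eqP; rewrite scaler_eq0; apply/orP; right.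
  by apply/negPn/negP => /pd; rewrite (eqP (hX0 w ws)) ltxx.
have [T T_lt0 Tfix] := timelike_fixed_vector (ds_metric_g ds) lor hb h_causal.
exists T; first by apply: contraTneq T_lt0 => ->; rewrite (sb0l gb) ltxx.
move=> Z; rewrite bracket_anti.
have := Tfix (ad br Z) (ds_ad_invariant ds Z); rewrite lfunE => -> //.
  by rewrite oppr0.
move=> X Y; rewrite !lfunE /=; apply/eqP; rewrite -addr_eq0 -big_split /=.
have tr0 := @orthonormal_skew_trace _ _ fv s (pi Z) (fun x y => fv (pi X x) (pi Y y))
  vb sE (ds_pi_invariant ds Z) _ _.
rewrite -[X in _ == X]oppr0 -{}[X in _ == - X]tr0; first last.
- by move=> a x y z; rewrite linearP (sbDr vb) (sbZr vb).
- by move=> a x y z; rewrite linearP (sbDl vb) (sbZl vb).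
rewrite -sumrN; apply/eqP/eq_bigr => w _.
rewrite !repr_bracket -!(scaleN1r (pi _ _)) !(sbDl vb, sbDr vb, sbZl vb, sbZr vb).
by rewrite (ds_pi_invariant ds Z); ring.
Qed.

(** With a zero centre, the Casimir form would provide a timelike vector of [v]
    killed by all [pi Z], against the absence of trivial subrepresentations. *)
Lemma lorentzian_module_center :
  (forall X, X != 0 -> 0 < fg X X) -> lorentzian fv ->
  exists2 T, T != 0 & forall Z, br T Z = 0.
Proof.
move=> pd lor; apply: contrapT => no.
have center0 T : (forall Z, br T Z = 0) -> T = 0.
  by move=> TZ; apply: contrapT => /eqP T0; apply: no; exists T.
have [s sE] := orthonormal_expansion gb pd.
have inv_line0 w : (forall Z, exists l, pi Z w = l *: w) -> w = 0.
  move=> line; apply/eqP/negPn/negP => w0.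
  have [z wz] : exists z, fv w z != 0.
    apply: contrapT => nz; move/eqP: w0; apply.
    apply: (nondegenerate_eq0 (ds_metric_v ds)) => z.
    by apply/eqP/negPn/negP => wz; apply: nz; exists z.
  (* [X |-> fv (pi X w) z] is, up to the factor [fv w z], the scalar by which
     [X] acts on the line of [w]; [Y] represents it through [fg]. *)
  pose Y := \sum_(e <- s) fv (pi e w) z *: e.
  have YE X : fg Y X = fv (pi X w) z.
    rewrite [in RHS](sE X) linear_sum sum_lfunE (sb_suml vb) (sb_suml gb).
    apply: eq_bigr => e _; rewrite linearZ /= lfun_simp (sbZl gb) (sbZl vb).
    by rewrite (sbC gb) mulrC.
  have Y0 : Y = 0.
    apply: center0 => Z; apply: (nondegenerate_eq0 (ds_metric_g ds)) => X.
    rewrite bracket_anti -scaleN1r (sbZl gb) ad_skew YE repr_bracket.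
    have [l lE] := line Z; have [m mE] := line X.
    rewrite lE mE !linearZ /= lE mE scalerN !scalerA (mulrC m) subrr.
    by rewrite (sb0l vb) oppr0 mulr0.
  case/eqP: w0; apply: (ds_no_trivial ds) => X.
  have [l lE] := line X; have := YE X.
  rewrite Y0 (sb0l gb) lE (sbZl vb) => /esym/eqP.
  by rewrite mulf_eq0 (negPf wz) orbF => /eqP ->; rewrite scale0r.
pose h x y := \sum_(e <- s) fv (pi e x) (pi e y).
have hb : symmetric_bilinear h.
  split=> [a x y z|x y]; last by apply: eq_bigr => e _; apply: sbC.
  rewrite mulr_sumr -big_split; apply: eq_bigr => e _ /=.
  by rewrite linearP (sbDl vb) (sbZl vb).
have h_causal x : x != 0 -> fv x x <= 0 -> 0 < h x x.
  move=> x0 xx.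
  have orth Z : fv x (pi Z x) = 0.
    by have := ds_pi_invariant ds Z x x; rewrite (sbC vb _ x); lra.
  (* If [h x x] vanishes, every [pi e x] is null and orthogonal to the causal
     vector [x], hence proportional to it. *)
  have co Z := causal_orthogonal (ds_metric_v ds) lor x0 xx (orth Z).
  rewrite lt_def sumr_ge0 => [|e _]; last exact: (co e).1.
  rewrite andbT; apply: contraNneq x0 => /eqP.
  rewrite psumr_eq0 => [|e _]; last exact: (co e).1.
  move=> /allP hx0; apply/eqP/inv_line0 => Z.
  rewrite (sE Z) linear_sum sum_lfunE big_seq.
  elim/big_ind: _ => [|_ _ [l ->] [m ->]|e es]; first by exists 0; rewrite scale0r.
    by exists (l + m); rewrite scalerDl.
  have [l lE] := (co e).2 (eqP (hx0 e es)).
  by exists (fg Z e * l); rewrite linearZ /= lfun_simp lE scalerA.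
have [T T_lt0 Tfix] := timelike_fixed_vector (ds_metric_v ds) lor hb h_causal.
move: T_lt0; rewrite (ds_no_trivial ds (w := T)) ?(sb0l vb) ?ltxx // => Z.
apply: Tfix; first exact: (ds_pi_invariant ds Z).
move=> x y; apply/eqP; rewrite -addr_eq0 -big_split /=.
have tr0 := @orthonormal_skew_trace _ _ fg s (br Z) (fun X Y => fv (pi X x) (pi Y y))
  gb sE (ad_skew Z) _ _.
rewrite -[X in _ == X]oppr0 -{}[X in _ == - X]tr0; first last.
- by move=> a X Y W; rewrite repr_linear (sbDr vb) (sbZr vb).
- by move=> a X Y W; rewrite repr_linear (sbDl vb) (sbZl vb).
rewrite -sumrN; apply/eqP/eq_bigr => e _.
rewrite !repr_bracket -!(scaleN1r (pi _ _)) !(sbDl vb, sbDr vb, sbZl vb, sbZr vb).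
by rewrite (ds_pi_invariant ds Z); ring.
Qed.

End DataSetCases.

Lemma center_ideal_solvable (R : realType) (g : vectType R)
    (br : {bilinear g -> g -> g}) :
  lie_bracket br -> ideal br (center br) /\ solvable_sub br (center br).
Proof.
move=> [alt _]; split.
  move=> x u /mem_center uZ; apply/mem_center => y.
  have -> : br x u = 0; last by rewrite linear0l.
  by have := alt (x + u); rewrite linearDl !linearDr !alt uZ !addr0 add0r.
exists 1%N; apply/eqP; rewrite -subv0 /=.
apply/span_subvP => _ /allpairsP[[x y] [xZ yZ ->]].
by rewrite (mem_center _ _ (vbasis_mem xZ)) mem0v.
Qed.

Theorem corollary3p8 (R : realType) (g v : vectType R)
    (br : {bilinear g -> g -> g}) (pi : 'Hom(g, 'End(v)))
    (fg : {symmetric g}) (fv : {symmetric v}) :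
  lorentzian_data_set br pi fg fv ->
  ~ semisimple br /\ center br <> 0%VS.
Proof.
move=> [ds sig].
have gb := form_symmetric_bilinear fg; have vb := form_symmetric_bilinear fv.
have [T T0 TZ] : exists2 T, T != 0 & forall Z, br T Z = 0.
  have [[U Uneg dimU] _] := sig.
  have [X0 Xneg] : exists X, sum_form fg fv X X < 0.
    exists (vpick U); apply: Uneg; first exact: memv_pick.
    by rewrite vpick0 -dimv_eq0 dimU.
  have orthog (X Y : g) (x y : v) : fg X X + fv x x < 0 ->
      fg X Y + fv x y = 0 -> 0 <= fg Y Y + fv y y.
    exact: (signature_one_orthogonal (a := (X, x)) (b := (Y, y)) sig).
  (* The sign of [fg] on the first component of a timelike vector tells which
     summand carries the negative direction. *)
  have [T_lt0|T_ge0] := ltP (fg X0.1 X0.1) 0.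
    apply: (lorentzian_algebra_center ds).
      split; first by exists X0.1.
      move=> a b aa ab; have := orthog a b 0 0.
      by rewrite !(sb0l vb) !addr0; apply.
    apply: (nondegenerate_psd_pos (ds_metric_v ds)) => x.
    have := orthog X0.1 0 0 x.
    by rewrite !(sb0l vb) !(sb0r gb) !addr0 add0r; apply.
  have x_lt0 : fv X0.2 X0.2 < 0 by move: Xneg; rewrite /sum_form; lra.
  apply: (lorentzian_module_center ds).
    apply: (nondegenerate_psd_pos (ds_metric_g ds)) => X.
    have := orthog 0 X X0.2 0.
    by rewrite !(sb0l gb) !(sb0r vb) !add0r !addr0; apply.
  split; first by exists X0.2.
  move=> a b aa ab; have := orthog 0 0 a b.
  by rewrite !(sb0l gb) !add0r; apply.
have c0 : center br <> 0%VS.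
  move=> c0; case/eqP: T0; apply/eqP; rewrite -memv0 -c0.
  exact/mem_center.
split=> // ss; have [cI cS] := center_ideal_solvable (ds_lie ds).
exact: c0 (ss _ cI cS).
Qed.
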